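(* Let $X$ be a paracompact space. (a) $X$ is locally connected if and only if $CU(X)$ is uniformly locally connected. (b) $X$ is locally path-connected if and only if $CU(X)$ is uniformly locally path-connected. (c) If $X$ is locally path-connected, then $X$ is semi-locally simply-connected if and only if $CU(X)$ is uniformly semi-locally simply-connected.
   Context: Paracompact spaces are Hausdorff. Entourages of uniform structures are taken to be symmetric. The canonical uniform structure $CU(X)$ on a topological space $X$: a symmetric set $E\subset X\times X$ is an entourage iff there is a partition of unity $f=\{f_s\}_{s\in S}$ on $X$ (a family of continuous functions $f_s\colon X\to[0,1]$ with $\sum_{s\in S}f_s(x)=1$ for all $x\in X$) such that $E$ contains $E_f:=\{(x,y)\in X\times X : \text{there is } s\in S\text{ with } f_s(x)\cdot f_s(y)>0\}$. For an entourage $E$, $B(x,E)=\{y : (x,y)\in E\}$; a subset (or a path or loop, via its image) is $E$-bounded if it is contained in $B(x,E)$ for some $x$. A uniform space is uniformly locally path-connected if for every entourage $E$ there is an entourage $F$ such that any pair $(x,y)\in F$ can be connected by an $E$-bounded path. It is uniformly locally connected if for every entourage $E$ there is an entourage $F$ such that for any pair $(x,y)\in F$ the points $x,y$ lie in an $E$-bounded connected subset. It is uniformly semi-locally simply-connected if there is an entourage $F$ such that any $F$-bounded loop in $X$ is null-homotopic in $X$. A topological space $X$ is semi-locally simply-connected if each $x\in X$ has a neighborhood $U$ such that every loop in $U$ based at $x$ is null-homotopic in $X$. *)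

(* Defs.v *)
From HB Require Import structures.
From mathcomp Require Import all_boot all_order all_algebra finmap.
From mathcomp Require Import all_classical all_reals all_analysis homotopy.
From mathcomp Require Import lra.

Set Implicit Arguments.
Unset Strict Implicit.
Unset Printing Implicit Defensive.

Import Order.TTheory GRing.Theory Num.Theory.
Import numFieldNormedType.Exports.

Local Open Scope classical_set_scope.
Local Open Scope ring_scope.

Definition partition_of_unity (R : realType) (X : topologicalType)
    (S : choiceType) (f : S -> X -> R) : Prop :=
  [/\ forall s, continuous (f s),
      forall s x, 0 <= f s x <= 1 &
      forall x, (\esum_(s in [set: S]) (f s x)%:E = 1)%E].

Definition pou_ent (R : realType) (X : topologicalType) (S : choiceType)
    (f : S -> X -> R) : set (X * X) :=
  [set xy | exists s, 0 < f s xy.1 * f s xy.2].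

(* All supersets of the sets pou_ent f; the entourages of CU(X) are the symmetric
   ones among them, see sym_entourage below. *)
Definition CU_ent (R : realType) (X : topologicalType) : set_system (X * X) :=
  [set E | exists (S : choiceType) (f : S -> X -> R),
     partition_of_unity f /\ pou_ent f `<=` E].

Arguments CU_ent R X : clear implicits.

Section PartitionOfUnity.
Context (R : realType) (X : topologicalType) (S : choiceType).
Variable f : S -> X -> R.
Hypothesis pf : partition_of_unity f.
Implicit Types (x y : X) (s : S) (K T : {fset S}) (A : set S).

Let f_ge0 s x : 0 <= f s x.
Proof. by case: pf => _ /(_ s x)/andP[]. Qed.

Let f_le1 s x : f s x <= 1.
Proof. by case: pf => _ /(_ s x)/andP[]. Qed.

Let f_cont s : continuous (f s).
Proof. by case: pf. Qed.

Let fsum_le1 K x : \sum_(s <- K) f s x <= 1.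
Proof.
case: pf => _ _ /(_ x) f1; rewrite -lee_fin -f1 -sumEFin.
rewrite fsbig_seq ?fset_uniq//; apply: ereal_sup_ubound.
by exists [set` K] => //; split.
Qed.

Let fsum_gt (e : R) x : 0 < e -> exists K, 1 - e < \sum_(s <- K) f s x.
Proof.
move=> e0; case: pf => _ _ /(_ x) f1.
have : ((1 - e)%:E < \esum_(s in [set: S]) (f s x)%:E)%E.
  by rewrite f1 lte_fin; lra.
move=> /ereal_sup_gt[_ [A [finA _] <-]].
rewrite fsbig_finite//= sumEFin lte_fin => eA.
by exists (fset_set A).
Qed.

Let fsum_notin K s x : s \notin K -> f s x <= 1 - \sum_(t <- K) f t x.
Proof.
move=> sK; have := fsum_le1 (s |` K)%fset x.
by rewrite big_fsetU1//=; lra.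
Qed.

Let near_fset K (P : S -> X -> Prop) x :
  (forall s, \forall y \near x, P s y) ->
  \forall y \near x, forall s, s \in K -> P s y.
Proof.
move=> nP; suff H (r : seq S) : \forall y \near x, forall s, s \in r -> P s y.
  exact: H.
elim: r => [|s r ih]; first by apply: nearW => y s; rewrite in_nil.
near=> y => t; rewrite in_cons => /orP[/eqP->|tr]; first by near: y; exact: nP.
by move: t tr; near: y.
Unshelve. all: by end_near. Qed.

Let f_equicontinuous x (e : R) : 0 < e ->
  \forall y \near x, forall s, `|f s x - f s y| <= e.
Proof.
move=> e0; have [K hK] := @fsum_gt (e / 2) x ltac:(lra).
have cK : \sum_(s <- K) f s y @[y --> x] --> \sum_(s <- K) f s x.
  by apply: cvg_big => [|s _]; [exact: add_continuous|exact: f_cont].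
have near1 : \forall y \near x, 1 - e < \sum_(s <- K) f s y.
  by apply: (cvgr_gt _ cK); lra.
have near2 : \forall y \near x, forall s, s \in K -> `|f s x - f s y| <= e.
  apply: near_fset => s; have /cvgrPdist_le := @f_cont s x; exact.
near=> y => s; have [sK|sK] := boolP (s \in K).
  by move: s sK; near: y.
have h1 := fsum_notin x sK; have h2 := fsum_notin y sK.
have h3 : 1 - e < \sum_(s <- K) f s y by near: y.
have := f_ge0 s x; have := f_ge0 s y.
by rewrite ler_norml => ? ?; apply/andP; split; lra.
Unshelve. all: by end_near. Qed.

Let supf A x : R := sup ([set 0] `|` [set f s x | s in A]).

Let supf_has A x : has_ubound ([set 0] `|` [set f s x | s in A]).
Proof. by exists 1 => _ [->//|[s _ <-]]. Qed.

Let supf_ge A s x : A s -> f s x <= supf A x.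
Proof. by move=> As; apply: ub_le_sup => //; right; exists s. Qed.

Let supf_ge0 A x : 0 <= supf A x.
Proof. by apply: ub_le_sup => //; left. Qed.

Let supf_le A x b : 0 <= b -> (forall s, A s -> f s x <= b) -> supf A x <= b.
Proof.
move=> b0 Ab; apply: ge_sup; first by exists 0; left.
by move=> _ [->//|[s As <-]]; exact: Ab.
Qed.

Let supf_equi A x y (e : R) : 0 < e -> (forall s, `|f s x - f s y| <= e) ->
  supf A x <= supf A y + e.
Proof.
move=> e0 xy; apply: supf_le => [|s As].
  by have := supf_ge0 A y; lra.
by have := @supf_ge _ _ y As; have := xy s; rewrite ler_norml => /andP[]; lra.
Qed.

Let supf_cont A : continuous (supf A).
Proof.
move=> x; apply/cvgrPdist_le => e e0.
near=> y; have xy : forall s, `|f s x - f s y| <= e.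
  by near: y; exact: f_equicontinuous.
have yx s : `|f s y - f s x| <= e by rewrite distrC.
have := supf_equi A e0 xy; have := supf_equi A e0 yx.
by rewrite ler_norml => ? ?; apply/andP; split; lra.
Unshelve. all: by end_near. Qed.

Let mu := supf setT.

Let mu_gt0 x : 0 < mu x.
Proof.
rewrite lt_neqAle supf_ge0 andbT; apply/eqP => mu0.
have [K] := @fsum_gt 1 x ltr01; rewrite big1 ?subrr ?ltxx// => s _.
apply/eqP; rewrite eq_le f_ge0 andbT.
by have := @supf_ge setT s x I; rewrite -/(mu x) -mu0.
Qed.

Let finite_above (c : R) x : 0 < c -> exists K, forall s, c < f s x -> s \in K.
Proof.
move=> c0; have [K hK] := @fsum_gt c x c0; exists K => s.
by apply: contraTT => /(fsum_notin x); rewrite -leNgt; lra.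
Qed.

Lemma pou_ent_refl x : pou_ent f (x, x).
Proof.
have [K] := @fsum_gt 1 x ltr01; rewrite subrr => K0.
apply: contrapT => nx; move: K0; rewrite big1 ?ltxx// => s _.
apply/eqP; rewrite eq_le f_ge0 andbT leNgt; apply/negP => s0.
by apply: nx; exists s; exact: mulr_gt0.
Qed.

(* The entourages of the barycentric subdivision of f halve those of f: the
   vertices of the subdivision are the nonempty finite sets T of indices, and
   bary T x > 0 forces f s x > f r x whenever s \in T and r \notin T. The
   cutoff by mu / 2 makes the family bary locally finite. *)
Let cut T x := Num.max (mu x / 2) (supf (~` [set` T]) x).

Let bary T x := #|` T|%:R * \prod_(s <- T) Num.max 0 (f s x - cut T x).

Let bary_ge0 T x : 0 <= bary T x.
Proof.
by rewrite mulr_ge0// prodr_ge0// => s _; rewrite le_max lexx.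
Qed.

Let bary_gt0P T x : 0 < bary T x <->
  T != fset0 /\ forall s, s \in T -> cut T x < f s x.
Proof.
split=> [b0|[T0 hT]].
  split=> [|s sT].
    by apply: contraTneq b0 => ->; rewrite /bary cardfs0 mul0r ltxx.
  rewrite ltNge; apply/negP => hs; move: b0.
  rewrite /bary (big_fsetD1 s)//= max_l ?subr_le0//.
  by rewrite mul0r mulr0 ltxx.
rewrite mulr_gt0 ?ltr0n ?cardfs_gt0// big_seq prodr_gt0// => s sT.
by rewrite lt_max subr_gt0 hT// orbT.
Qed.

Let bary_cont T : continuous (bary T).
Proof.
move=> x; apply: cvgM; first exact: cvg_cst.
apply: cvg_big => [|s _]; first exact: mul_continuous.
apply: (@continuous_max _ _ (fun=> 0) (fun y => f s y - cut T y)).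
  exact: cvg_cst.
apply: cvgB; first exact: f_cont.
apply: (@continuous_max _ _ (fun y => mu y / 2) (supf (~` [set` T]))).
  by apply: cvgMl; exact: supf_cont.
exact: supf_cont.
Qed.

Let bary_locfin x : exists K, \forall y \near x, forall T,
  ~~ (T `<=` K)%fset -> bary T y = 0.
Proof.
have m0 := mu_gt0 x; have [K hK] := @finite_above (mu x / 4) x ltac:(lra).
exists K; have e0 : 0 < mu x / 8 by lra.
near=> y => T TK; apply/eqP; rewrite eq_le bary_ge0 andbT leNgt.
apply/negP => /bary_gt0P[_ hT]; move/negP : TK; apply.
apply/fsubsetP => s /hT; rewrite gt_max => /andP[hs _]; apply: hK.
have xy : forall s, `|f s x - f s y| <= mu x / 8.
  by near: y; exact: f_equicontinuous.
have := @supf_equi setT _ _ _ e0 xy; rewrite -!/(mu _).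
by have := xy s; rewrite ler_norml => /andP[]; lra.
Unshelve. all: by end_near. Qed.

Let bary_ex x : exists T, 0 < bary T x.
Proof.
have m0 := mu_gt0 x; have [K hK] := @finite_above (mu x / 2) x ltac:(lra).
have [s0 hs0] : exists s, mu x / 2 < f s x.
  apply: contrapT => /forallNP h; suff : mu x <= mu x / 2 by lra.
  by apply: supf_le => [|s _]; [lra|rewrite leNgt; apply/negP; exact: h].
pose m := \big[Order.max/mu x / 2]_(s <- K) f s x.
have ms s : f s x <= m.
  have [sK|sK] := boolP (s \in K); first exact: le_bigmax_seq.
  rewrite (@le_trans _ _ (mu x / 2))// ?bigmax_ge_id// leNgt.
  by apply: contra sK => /hK.
have m_half : mu x / 2 < m by exact: lt_le_trans (ms s0).
pose T := [fset s in K | f s x == m]%fset.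
have [s1 s1T] : exists s, s \in T.
  apply: contrapT => /forallNP h.
  have : m < m by rewrite {1}/m; rewrite big_seq; apply: bigmax_lt => // s sK;
    rewrite lt_neqAle ms andbT; apply/negP => hs; apply: (h s); rewrite !inE sK.
  by rewrite ltxx.
exists T; apply/bary_gt0P; split; first by apply/fset0Pn; exists s1.
move=> s; rewrite !inE => /andP[sK /eqP->]; rewrite gt_max m_half/=.
pose m' := \big[Order.max/mu x / 2]_(s <- K | f s x != m) f s x.
have m'm : m' < m by apply: bigmax_lt => // t tm; rewrite lt_neqAle tm ms.
apply: le_lt_trans m'm; apply: supf_le => [|t /= tT].
  by rewrite (@le_trans _ _ (mu x / 2)) ?bigmax_ge_id//; lra.
have [tK|tK] := boolP (t \in K).
  apply: le_bigmax_seq => //; apply/negP => /eqP tm; apply: tT.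
  by rewrite !inE tK tm eqxx.
rewrite (@le_trans _ _ (mu x / 2)) ?bigmax_ge_id// leNgt.
by apply: contra tK => /hK.
Qed.

Let total x : R := \sum_(T \in [set: {fset S}]) bary T x.

Let total_loc x : exists K, \forall y \near x,
  (forall T, ~~ (T `<=` K)%fset -> bary T y = 0) /\
  total y = \sum_(T <- fpowerset K) bary T y.
Proof.
have [K hK] := bary_locfin x; exists K; near=> y.
have hy : forall T, ~~ (T `<=` K)%fset -> bary T y = 0 by near: y.
split=> //; rewrite fsbig_seq ?fset_uniq//; apply/esym/fsbig_widen => //.
move=> T [_ /= TK]; apply: hy; apply/negP => h; apply: TK.
by rewrite fpowersetE.
Unshelve. all: by end_near. Qed.

Let total_cont : continuous total.
Proof.
move=> x; have [K hK] := total_loc x.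
have [_ tx] := nbhs_singleton hK.
rewrite /continuous_at tx.
apply: (@cvg_trans _ (\sum_(T <- fpowerset K) bary T y @[y --> x])).
  by apply: near_eq_cvg; apply: filterS hK => y [].
by apply: cvg_big => [|T _]; [exact: add_continuous|exact: bary_cont].
Qed.

Let bary_le_total T x : bary T x <= total x.
Proof.
have [K /nbhs_singleton[hK ->]] := total_loc x.
have [TK|/hK->] := boolP (T `<=` K)%fset; last exact: sumr_ge0.
rewrite (big_fsetD1 T) ?fpowersetE//= lerDl.
exact: sumr_ge0.
Qed.

Let total_gt0 x : 0 < total x.
Proof. by have [T /lt_le_trans] := bary_ex x; apply; exact: bary_le_total. Qed.

Let g T x := bary T x / total x.

Let g_pou : partition_of_unity g.
Proof.
split=> [T x|T x|x].
- apply: cvgM; first exact: bary_cont.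
  by apply: cvgV; [rewrite gt_eqF|exact: total_cont].
- by rewrite /g ler_pdivrMr// mul1r bary_le_total andbT divr_ge0// ltW.
- have [K /nbhs_singleton[hK tx]] := total_loc x.
  rewrite (esumID [set` fpowerset K]) => [|T _]; last first.
    by rewrite lee_fin divr_ge0// ltW.
  rewrite [X in (_ + X)%E]esum1 ?adde0 => [|T [_ /= TK]]; last first.
    by rewrite /g hK ?mul0r//; apply/negP => h; apply: TK; rewrite fpowersetE.
  rewrite setTI esum_fset//; last by move=> T _; rewrite lee_fin divr_ge0// ltW.
  rewrite -fsbig_seq ?fset_uniq// sumEFin -mulr_suml -tx divff//.
  by rewrite gt_eqF.
Qed.

Let bary_chain T T' x : 0 < bary T x -> 0 < bary T' x ->
  (T `<=` T')%fset \/ (T' `<=` T)%fset.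
Proof.
move=> /bary_gt0P[_ h] /bary_gt0P[_ h'].
have [|/fsubsetPn[s sT sT']] := boolP (T `<=` T')%fset; first by left.
right; apply: contraT => /fsubsetPn[t tT' tT].
have := h _ sT; have := h' _ tT'; rewrite !gt_max.
have := @supf_ge (~` [set` T]) t x (negP tT).
have := @supf_ge (~` [set` T']) s x (negP sT').
by move=> ? ? /andP[_ ?] /andP[_ ?]; lra.
Qed.

Let bary_f T s x : 0 < bary T x -> s \in T -> 0 < f s x.
Proof.
move=> /bary_gt0P[_ h] /h; rewrite gt_max => /andP[+ _].
by have := mu_gt0 x; lra.
Qed.

Lemma pou_ent_split : exists (S' : choiceType) (g : S' -> X -> R),
  partition_of_unity g /\
  forall x y z, pou_ent g (x, y) -> pou_ent g (y, z) -> pou_ent f (x, z).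
Proof.
exists {fset S}, g; split=> //.
have gP T x y : 0 < g T x * g T y -> 0 < bary T x /\ 0 < bary T y.
  have bt u : bary T u = 0 -> g T u = 0 by rewrite /g => ->; rewrite mul0r.
  move=> gg; split; rewrite lt_neqAle bary_ge0 andbT eq_sym; apply/eqP => /bt g0.
    by move: gg; rewrite g0 mul0r ltxx.
  by move: gg; rewrite g0 mulr0 ltxx.
move=> x y z [T /gP[/= Tx Ty]] [T' /gP[/= T'y T'z]].
have [TT'|T'T] := bary_chain Ty T'y.
  have [/fset0Pn[s sT] _] := (bary_gt0P T y).1 Ty.
  exists s; rewrite mulr_gt0 ?(bary_f Tx)// (bary_f T'z)//.
  exact: (fsubsetP TT').
have [/fset0Pn[s sT'] _] := (bary_gt0P T' y).1 T'y.
exists s; rewrite mulr_gt0 ?(bary_f T'z)// (bary_f Tx)//.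
exact: (fsubsetP T'T).
Qed.

End PartitionOfUnity.

(* X with its canonical uniform structure. The topology carried by CU R X is the
   one induced by these entourages. *)
Definition CU (R : realType) (X : topologicalType) : Type := X.

Section CanonicalUniformity.
Context (R : realType) (X : topologicalType).
Implicit Types E : set (X * X).

Let CU_filter : Filter (CU_ent R X).
Proof.
split.
- exists unit, (fun=> cst 1); split=> //; split=> [_|_ x|x].
  + exact: cst_continuous.
  + by rewrite ler01 lexx.
  + rewrite (_ : [set: unit] = [set tt]); last by apply/seteqP; split=> -[].
    by rewrite esum_set1.
- move=> E F [S [f [pf fE]]] [T [g [pg gF]]].
  have [fc f01 f1] := pf; have [gc g01 g1] := pg.
  have f0 s x : 0 <= f s x by case/andP: (f01 s x).
  have g0 s x : 0 <= g s x by case/andP: (g01 s x).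
  exists (S * T)%type, (fun st x => f st.1 x * g st.2 x); split; last first.
    move=> [x y] [[s t] /= h].
    have [fx gx] : 0 < f s x * f s y /\ 0 < g t x * g t y.
      split; rewrite lt_neqAle mulr_ge0// andbT; apply/eqP => e0; move: h;
        by rewrite mulrACA -e0 ?mul0r ?mulr0 ltxx.
    by split; [apply: fE; exists s|apply: gF; exists t].
  split=> [[s t] x|[s t] x|x] /=.
  + by apply: cvgM; [exact: fc|exact: gc].
  + rewrite mulr_ge0//= mulr_ile1//.
      by case/andP: (f01 s x).
    by case/andP: (g01 t x).
  + transitivity (\esum_(s in [set: S]) \esum_(t in [set: T])
      (f s x * g t x)%:E)%E.
      rewrite esum_esum; last by move=> *; rewrite lee_fin mulr_ge0.
      by congr esum; apply/seteqP; split.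
    rewrite -(f1 x); apply: eq_esum => s _.
    rewrite -[RHS]mule1 -(g1 x) /esum -ereal_supZl//; last first.
      by apply/set0P; exists (\sum_(t \in set0) (g t x)%:E)%E; exists set0.
    congr ereal_sup; rewrite image_comp; apply: eq_imagel => A [finA _] /=.
    by rewrite !fsbig_finite//= !sumEFin -EFinM mulr_sumr.
- move=> E F EF [S [f [pf fE]]]; exists S, f; split=> //.
  exact: subset_trans EF.
Qed.

Let CU_diagonal E : CU_ent R X E -> diagonal `<=` E.
Proof.
move=> [S [f [pf fE]]] [x y]; rewrite /diagonal/mkset/= => ->; apply: fE; exact: pou_ent_refl.
Qed.

Let CU_inv E : CU_ent R X E -> CU_ent R X (E^-1)%relation.
Proof.
move=> [S [f [pf fE]]]; exists S, f; split=> // -[x y] [s /= h].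
by apply: fE; exists s; rewrite mulrC.
Qed.

Let CU_split_ex E : CU_ent R X E ->
  exists2 F, CU_ent R X F & (F \; F)%relation `<=` E.
Proof.
move=> [S [f [pf fE]]]; have [S' [g [pg gf]]] := pou_ent_split pf.
exists (pou_ent g); first by exists S', g; split.
by move=> [x z] [y /= xy yz]; apply: fE; exact: gf xy yz.
Qed.

HB.instance Definition _ := Choice.copy (CU R X) X.

HB.instance Definition _ := isUniform.Build (CU R X)
  CU_filter CU_diagonal CU_inv CU_split_ex.

End CanonicalUniformity.

Definition unit_interval (R : realType) : Type := set_type (`[0, 1]%classic : set R).

HB.instance Definition _ (R : realType) :=
  Topological.copy (unit_interval R) (set_type (`[0, 1]%classic : set R)).

Section UnitIntervalEnds.
Context (R : realType).

Let mem_zero : (0 : R) \in (`[0, 1]%classic : set R).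
Proof. by rewrite inE/= in_itv/= lexx ler01. Qed.

Let mem_one : (1 : R) \in (`[0, 1]%classic : set R).
Proof. by rewrite inE/= in_itv/= ler01 lexx. Qed.

Let ends_neq :
  (exist _ 0 mem_zero : unit_interval R) != exist _ 1 mem_one.
Proof. by apply/eqP => -[/esym/eqP]; rewrite oner_eq0. Qed.

HB.instance Definition _ := @isBiPointed.Build (unit_interval R)
  (exist _ 0 mem_zero) (exist _ 1 mem_one) ends_neq.

End UnitIntervalEnds.

Section TopologicalNotions.
Context (R : realType) (T : topologicalType).
Local Notation I := (unit_interval R).

Definition locally_finite_cover (D : set (set T)) : Prop :=
  forall x : T, exists2 U, nbhs x U & finite_set [set V | D V /\ V `&` U !=set0].

Definition paracompact : Prop :=
  hausdorff_space T /\
  forall C : set (set T), C `<=` open -> \bigcup_(V in C) V = setT ->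
    exists D : set (set T),
      [/\ D `<=` open, \bigcup_(V in D) V = setT,
          forall V, D V -> exists2 W, C W & V `<=` W &
          locally_finite_cover D].

Definition locally_connected : Prop :=
  forall (x : T) (U : set T), nbhs x U ->
    exists V, [/\ open V, V x, connected V & V `<=` U].

Definition path_connected (A : set T) : Prop :=
  forall x y, A x -> A y ->
    exists p : {path I from x to y in T}, range p `<=` A.

Definition locally_path_connected : Prop :=
  forall (x : T) (U : set T), nbhs x U ->
    exists V, [/\ open V, V x, path_connected V & V `<=` U].

(* Homotopy to the constant loop relative to the base point. *)
Definition null_homotopic (x : T) (p : {path I from x to x in T}) : Prop :=
  exists H : I * I -> T,
    [/\ continuous H,
        forall s, H (s, zero) = p s,
        forall s, H (s, one) = x &
        forall t, H (zero, t) = x /\ H (one, t) = x].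

Definition semi_locally_simply_connected : Prop :=
  forall x : T, exists2 U, nbhs x U &
    forall p : {path I from x to x in T}, range p `<=` U -> null_homotopic p.

End TopologicalNotions.

Section UniformNotions.
Context (R : realType) (T : uniformType).
Local Notation I := (unit_interval R).

(* The library's entourages are closed under supersets, hence need not be
   symmetric. *)
Definition sym_entourage (E : set (T * T)) : Prop :=
  entourage E /\ (E^-1)%relation = E.

Definition ent_bounded (E : set (T * T)) (A : set T) : Prop :=
  exists x, A `<=` [set y | E (x, y)].

Definition uniformly_locally_connected : Prop :=
  forall E, sym_entourage E -> exists2 F, sym_entourage F &
    forall x y, F (x, y) ->
      exists A, [/\ connected A, ent_bounded E A, A x & A y].

Definition uniformly_locally_path_connected : Prop :=
  forall E, sym_entourage E -> exists2 F, sym_entourage F &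
    forall x y, F (x, y) ->
      exists p : {path I from x to y in T}, ent_bounded E (range p).

Definition uniformly_semi_locally_simply_connected : Prop :=
  exists2 F, sym_entourage F &
    forall (x : T) (p : {path I from x to x in T}),
      ent_bounded F (range p) -> null_homotopic p.

End UniformNotions.

(* Main.v *)
Require Import Defs.
From HB Require Import structures.
From mathcomp Require Import all_boot all_order all_algebra finmap.
From mathcomp Require Import all_classical all_reals all_analysis homotopy.
From mathcomp Require Import lra.

Set Implicit Arguments.
Unset Strict Implicit.
Unset Printing Implicit Defensive.

Import Order.TTheory GRing.Theory Num.Theory.
Import numFieldNormedType.Exports.

Local Open Scope classical_set_scope.
Local Open Scope ring_scope.

(** Partitions of unity are as plentiful on a paracompact space X as open
covers: every open cover has a partition of unity each of whose members is
positive only inside some member of the cover ([subordinate_pou]). Read in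
terms of CU(X), this says that any open cover has an entourage F such that F
(x, y) puts x and y in a common member of the cover ([subordinate_entourage]).
Applied to the cover by an open neighbourhood of x and the complement of x, it
shows that CU(X) induces the topology of X ([nbhs_CU]), so connectedness, paths
and homotopies mean the same in both spaces.

From local to uniform: given an entourage E, the sets that are open, E-bounded
and connected (or path-connected) cover X when X is locally connected (locally
path-connected), and an entourage subordinate to this cover does what uniform
local (path-)connectedness asks for. From uniform to local: if U is open and y
is in the (path) component C of x in U, then for E small enough every E-bounded
set through y stays in U; so all points F-close to y are joined to y inside U,
and C is a neighbourhood of y. Hence components of open sets are open.

For simple connectedness, the uniform property trivially gives the local one,
since F-balls are neighbourhoods. For the converse, cover X by open
path-connected sets V having a base point x at which all loops of V are null.
Here pairs of close points do not suffice: whole F-balls must lie in members of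
the cover ([star_subordinate_entourage]). A loop in such a ball lies in a V,
but is based at an arbitrary y; it is conjugated by a path of V from x to y,
and the null-homotopy of the conjugate is turned into one of the original loop
([conjugate_loop]).

Paths and homotopies are handled as maps defined on R and R * R, of which only
the restriction to the unit interval or square matters: reparametrizations are
then plain real functions. *)

(** * Separation and shrinking in paracompact spaces *)

Section LocallyFinite.
Context (X : topologicalType).
Implicit Types (A B K U V W : set X) (C D : set (set X)) (x y : X).

(** Local finiteness lets a family of conditions indexed by D hold
simultaneously near x: only finitely many members of D meet a small
neighbourhood of x, and for the others the condition is assumed to be vacuous.
*)
Lemma near_locally_finite D (Q : set X -> set X) x : locally_finite_cover D ->
  (forall V y, D V -> ~ V x -> ~ V y -> Q V y) ->
  (forall V, D V -> \forall y \near x, Q V y) ->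
  \forall y \near x, forall V, D V -> Q V y.
Proof.
move=> /(_ x)[U Ux finU] Qout Qnear.
pose M := [set V | D V /\ V `&` U !=set0].
have : nbhs x (\bigcap_(V in [set` fset_set M]) Q V).
  apply: filter_bigI => V; rewrite in_fset_set// inE => -[DV _].
  exact: Qnear.
rewrite fset_setK// => Mx; near=> y => V DV.
have [VU|VU] := pselect (V `&` U !=set0).
  by have /(_ V) : (\bigcap_(V in M) Q V) y; [near: y|apply].
apply: Qout => // [Vx|Vy]; apply: VU.
  by exists x; split=> //; exact: nbhs_singleton.
by exists y; split=> //; near: y.
Unshelve. all: by end_near. Qed.

Lemma nbhs_setC x A : ~ closure A x -> nbhs x (~` A).
Proof. by rewrite -[closure A]setCK -interiorC => /contrapT. Qed.

(** Closures commute with locally finite unions. *)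
Lemma closure_locally_finite D (P : set (set X)) x : locally_finite_cover D ->
  P `<=` D -> (forall V, P V -> ~ closure V x) ->
  nbhs x (~` \bigcup_(V in P) V).
Proof.
move=> lfD PD ncl.
have : \forall y \near x, forall V, D V -> (P V -> ~ V y).
  apply: near_locally_finite => // V DV.
  have [PV|nPV] := pselect (P V); last by apply: nearW.
  by apply: filterS (nbhs_setC (ncl V PV)).
apply: filterS => y hy [V PV Vy].
exact: hy (PD V PV) PV Vy.
Qed.

End LocallyFinite.

Section Paracompact.
Context (X : topologicalType).
Hypothesis hX : paracompact X.
Implicit Types (A B K U V W : set X) (C D : set (set X)) (x y : X).

Let refine C : C `<=` open -> (forall x, exists2 W, C W & W x) ->
  exists D, [/\ D `<=` open, forall x, exists2 V, D V & V x,
    forall V, D V -> exists2 W, C W & V `<=` W & locally_finite_cover D].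
Proof.
move=> oC cC; case: hX => _ /(_ C oC)[|D [oD cD DC lfD]].
  by apply/seteqP; split=> // x _; have [W CW Wx] := cC x; exists W.
exists D; split=> // x; have : [set: X] x by [].
by rewrite -cD => -[V DV Vx]; exists V.
Qed.

(** The engine behind both regularity and normality: refine the cover made of
the complement of A and of the local separating sets W, and take the union of
the members of the refinement that meet A. By local finiteness, its closure is
a union of closures, each of which avoids B. With B a point this turns the
Hausdorff property into regularity; with B closed it turns regularity into
normality. *)
Lemma separate_local A B : closed A ->
  (forall a, A a -> exists W,
    [/\ open W, W a & forall b, B b -> nbhs b (~` W)]) ->
  exists W, [/\ open W, A `<=` W & forall b, B b -> nbhs b (~` W)].
Proof.
move=> cA hA.
pose C := [set W | open W /\ (W `<=` ~` A \/ forall b, B b -> nbhs b (~` W))].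
have [|x|D [oD cD DC lfD]] := @refine C; first by move=> W [].
  have [/hA[W [oW Wx WB]]|nAx] := pselect (A x).
    by exists W => //; split=> //; right.
  by exists (~` A) => //; split; [rewrite openC|left].
pose P := [set V | D V /\ V `&` A !=set0].
exists (\bigcup_(V in P) V); split.
- by apply: bigcup_open => V [/oD].
- by move=> a Aa; have [V DV Va] := cD a; exists V => //; split=> //; exists a.
- move=> b Bb; apply: closure_locally_finite lfD _ _ => [V []//|].
  move=> V [DV [a [Va Aa]]].
  have [W [_ CW] VW] := DC V DV; case: CW => [/(_ a (VW a Va))//|/(_ b Bb) bW].
  by move=> /(_ _ bW)[z [/VW]].
Qed.

Lemma paracompact_regular x U : nbhs x U ->
  exists W, [/\ open W, W x & closure W `<=` U].
Proof.
move=> Ux; have [|a nUa|W [oW UW Wx]] := @separate_local (~` U°) [set x].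
- by rewrite closedC; exact: open_interior.
- have xa : x != a by apply/eqP => xa; apply: nUa; rewrite -xa.
  case: hX => + _; rewrite open_hausdorff => /(_ x a xa)[[P Q]/=].
  rewrite !inE => -[Px Qa] [oP oQ PQ]; exists Q; split=> // _ ->.
  apply: filterS (open_nbhs_nbhs (conj oP Px)) => z Pz Qz.
  by have : (P `&` Q) z by []; rewrite PQ.
exists (~` W)°; split; [exact: open_interior|exact: Wx|].
apply: (@subset_trans _ (~` W)); last first.
  move=> z nWz; apply: contrapT => nUz; apply: nWz.
  by apply: UW => /interior_subset.
have cW : closed (~` W) by rewrite closedC.
rewrite [X in _ `<=` X]((closure_id _).1 cW).
by apply: closureS; exact: interior_subset.
Qed.

Lemma paracompact_normal : normal_space X.
Proof.
move=> A cA B /set_nbhsP[N [oN AN NB]].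
have [a Aa|W [oW AW WN]] := @separate_local A (~` N) cA.
  have Na : nbhs a N by apply: open_nbhs_nbhs; split=> //; exact: AN.
  have [W [oW Wa WN]] := paracompact_regular Na.
  by exists W; split=> // b nNb; apply: nbhs_setC => /WN.
exists W; first by apply/set_nbhsP; exists W; split.
apply: subset_trans NB => x Wx; apply: contrapT => /WN nWx.
by have [z []] := Wx _ nWx.
Qed.

(** Closed shrinking of a locally finite refinement D. No transfinite argument
is needed: K V collects the closures of the members of a second, finer, locally
finite cover that fit inside V. *)
Lemma paracompact_shrink C : C `<=` open -> (forall x, exists2 W, C W & W x) ->
  exists D (K : set X -> set X),
    [/\ locally_finite_cover D,
        forall V, D V -> [/\ open V, closed (K V) & K V `<=` V],
        forall V, D V -> exists2 W, C W & V `<=` W &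
        forall x, exists2 V, D V & K V x].
Proof.
move=> oC cC; have [D [oD cD DC lfD]] := refine oC cC.
pose C' := [set W | open W /\ exists2 V, D V & closure W `<=` V].
have [|x|E [oE cE EC lfE]] := @refine C'; first by move=> W [].
  have [V DV Vx] := cD x.
  have V_nbhs : nbhs x V by apply: open_nbhs_nbhs; split=> //; exact: oD.
  have [W [oW Wx WV]] := paracompact_regular V_nbhs.
  by exists W => //; split=> //; exists V.
pose K V := \bigcup_(W in [set W | E W /\ closure W `<=` V]) closure W.
exists D, K; split=> // [V DV|x].
  split; [exact: oD| |by move=> x [W [_ WV] /WV]].
  rewrite -openC openE => x nKx.
  have : nbhs x (~` \bigcup_(W in [set W | E W /\ closure W `<=` V]) W).
    apply: closure_locally_finite lfE _ _ => [W []//|W [EW WV] Wx].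
    by apply: nKx; exists W.
  move=> /nbhs_interior; apply: filterS => y Ny [W PW Wy].
  by have [z [Wz nWz]] := Wy _ Ny; apply: nWz; exists W.
have [W EW Wx] := cE x; have [W' [_ [V DV WV]] WW'] := EC W EW.
exists V => //; exists W; last exact: subset_closure.
by split=> //; exact: subset_trans (closureS WW') WV.
Qed.

End Paracompact.

(** * Partitions of unity subordinate to a cover *)

Section Normalize.
Context (R : realType) (X : topologicalType) (S : choiceType).
Variable g : S -> X -> R.
Hypothesis g_cont : forall s, continuous (g s).
Hypothesis g_ge0 : forall s x, 0 <= g s x.
Hypothesis g_locfin : forall x : X, exists K : {fset S},
  \forall y \near x, forall s, s \notin K -> g s y = 0.
Hypothesis g_pos : forall x, exists s, 0 < g s x.

Let total x : R := \sum_(s \in [set: S]) g s x.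

Let total_loc (x : X) : exists K : {fset S}, \forall y \near x,
  (forall s, s \notin K -> g s y = 0) /\ total y = \sum_(s <- K) g s y.
Proof.
have [K hK] := g_locfin x; exists K; apply: filterS hK => y hy; split=> //.
rewrite fsbig_seq ?fset_uniq//; apply/esym/fsbig_widen => // s [_ /= sK].
by apply: hy; exact/negP.
Qed.

Let total_cont : continuous total.
Proof.
move=> x; have [K hK] := total_loc x.
have [_ tx] := nbhs_singleton hK; rewrite /continuous_at tx.
apply: (@cvg_trans _ (\sum_(s <- K) g s y @[y --> x])).
  by apply: near_eq_cvg; apply: filterS hK => y [].
by apply: cvg_big => [|s _]; [exact: add_continuous|exact: g_cont].
Qed.

Let g_le_total s x : g s x <= total x.
Proof.
have [K /nbhs_singleton[hK ->]] := total_loc x.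
have [sK|/hK->] := boolP (s \in K); last exact: sumr_ge0.
by rewrite (big_fsetD1 s)//= lerDl sumr_ge0.
Qed.

Let total_gt0 x : 0 < total x.
Proof. by have [s /lt_le_trans] := g_pos x; apply. Qed.

(** The total is continuous because near each point it is a finite sum. *)
Lemma normalized_pou : exists f : S -> X -> R,
  partition_of_unity f /\ forall s x, 0 < f s x -> 0 < g s x.
Proof.
exists (fun s x => g s x / total x); split=> [|s x]; last first.
  by rewrite pmulr_lgt0// invr_gt0.
split=> [s x|s x|x].
- apply: cvgM; first exact: g_cont.
  by apply: cvgV; [rewrite gt_eqF|exact: total_cont].
- by rewrite ler_pdivrMr// mul1r g_le_total andbT divr_ge0// ltW.
- have [K /nbhs_singleton[hK tx]] := total_loc x.
  rewrite (esumID [set` K]) => [|s _]; last by rewrite lee_fin divr_ge0// ltW.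
  rewrite [X in (_ + X)%E]esum1 ?adde0 => [|s [_ /= sK]]; last first.
    by rewrite hK ?mul0r//; exact/negP.
  rewrite setTI esum_fset//; last by move=> s _; rewrite lee_fin divr_ge0// ltW.
  rewrite -fsbig_seq ?fset_uniq// sumEFin -mulr_suml -tx divff//.
  by rewrite gt_eqF.
Qed.

End Normalize.

(** * Entourages subordinate to a cover *)

Section Subordinate.
Context (R : realType) (X : topologicalType).
Hypothesis hX : paracompact X.
Implicit Types (C : set (set X)) (x y : X).

(** Normalize Urysohn functions that equal 1 on the closed shrinking of a
locally finite refinement and vanish outside its members. *)
Lemma subordinate_pou C : C `<=` open -> (forall x, exists2 W, C W & W x) ->
  exists f : set X -> X -> R, partition_of_unity f /\
    forall s x, 0 < f s x -> exists2 W, C W & [set y | 0 < f s y] `<=` W.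
Proof.
move=> oC cC; have [D [K [lfD DP DC KD]]] := paracompact_shrink hX oC cC.
have /choice[g gP] : forall V, exists h : X -> R, [/\ continuous h,
    forall x, 0 <= h x, forall x, 0 < h x -> D V /\ V x &
    D V -> forall x, K V x -> 0 < h x].
  move=> V; have [DV|nDV] := pselect (D V); last first.
    by exists (fun=> 0); split=> // [x|x]; [exact: cvg_cst|rewrite ltxx].
  have [oV cK KV] := DP V DV.
  have /(@uniform_separatorP _ R)[h [ch h01 h0 h1]] :
    uniform_separator (~` V) (K V).
    apply: (@normal_separatorP R X).1 (paracompact_normal hX) _ _ _ _ _ => //.
      by rewrite closedC.
    by apply/disjoints_subset; exact: subsetC.
  have hge0 x : 0 <= h x.
    by have /h01 : range h (h x); [exists x|rewrite /= in_itv => /andP[]].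
  exists h; split=> // [x hx|_ x Kx].
    split=> //; apply: contrapT => nVx; have : h x = 0 by apply: h0; exists x.
    by move: hx => /[swap] ->; rewrite ltxx.
  by have -> : h x = 1 by apply: h1; exists x.
have [||x|x|f [pf fg]] := @normalized_pou R X (set X) g.
- by move=> V; case: (gP V).
- by move=> V; case: (gP V).
- have [U Ux finU] := lfD x; exists (fset_set [set V | D V /\ V `&` U !=set0]).
  apply: filterS Ux => y Uy V; rewrite in_fset_set// notin_setE => nV.
  have [_ g0 gD _] := gP V; apply/eqP; rewrite eq_le g0 andbT leNgt.
  by apply/negP => /gD[DV Vy]; apply: nV; split=> //; exists y.
- have [V DV Kx] := KD x; exists V.
  by case: (gP V) => _ _ _; apply.
exists f; split=> // V x /fg gx; have [_ _ gD _] := gP V.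
have [/DC[W CW VW] _] := gD x gx; exists W => // y /= /fg /gD[_ /VW].
exact.
Qed.

Lemma subordinate_entourage C : C `<=` open ->
  (forall x, exists2 W, C W & W x) ->
  exists2 F : set (CU R X * CU R X), sym_entourage F &
    forall x y, F (x, y) -> exists2 W, C W & W x /\ W y.
Proof.
move=> oC cC; have [f [pf fC]] := subordinate_pou oC cC.
have f_ge0 s x : 0 <= f s x by case: pf => _ /(_ s x)/andP[].
exists (pou_ent f).
  split; first by exists (set X), f; split.
  by apply/seteqP; split=> -[x y] [s /= fs]; exists s; rewrite mulrC.
move=> x y [s /= fs].
have fx : 0 < f s x.
  rewrite lt_neqAle f_ge0 andbT; apply: contraTneq fs => <-.
  by rewrite mul0r ltxx.
have [W CW fW] := fC s x fx; exists W => //.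
split; apply: fW => /=; first exact: fx.
by move: fs; rewrite pmulr_rgt0.
Qed.

(** Unlike in [subordinate_entourage], a single member of the cover contains
the whole ball around x. Shrink the cover to closed sets K V and let N x be the
set of y that lie in every V with K V x, and in no K V avoiding x; it is a
neighbourhood of x by local finiteness. If z and y lie in a common N w and K V
z, then K V w, whence V y: the set V depends on z only. *)
Lemma star_subordinate_entourage C : C `<=` open ->
  (forall x, exists2 W, C W & W x) ->
  exists2 F : set (CU R X * CU R X), sym_entourage F &
    forall x, exists2 W, C W & forall y, F (x, y) -> W y.
Proof.
move=> oC cC; have [D [K [lfD DP DC KD]]] := paracompact_shrink hX oC cC.
pose N x := [set y | forall V, D V -> (K V x -> V y) /\ (K V y -> K V x)].
have Nnear x : nbhs x (N x).
  apply: near_locally_finite lfD _ _ => [V y DV Vx Vy|V DV].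
    by have [_ _ KV] := DP V DV; split=> /KV.
  have [oV cK KV] := DP V DV; apply: filterI.
    have [Kx|nKx] := pselect (K V x); last by apply: nearW.
    by apply: filterS (open_nbhs_nbhs (conj oV (KV x Kx))).
  have [Kx|nKx] := pselect (K V x); first by apply: nearW.
  have : nbhs x (~` K V) by apply: open_nbhs_nbhs; split; rewrite ?openC.
  by apply: filterS.
have [|x|F symF FN] := @subordinate_entourage [set (N x)° | x in setT].
- by move=> _ [x _ <-]; exact: open_interior.
- by exists (N x)°; [exists x|exact: Nnear].
exists F => // x; have [V DV Kx] := KD x; have [W CW VW] := DC V DV.
exists W => // y /FN[_ [z _ <-] [/interior_subset zx /interior_subset zy]].
by apply: VW; apply: (zy V DV).1; apply: (zx V DV).2.
Qed.

End Subordinate.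

(** * The topology of CU(X) *)

Section Topology.
Context (R : realType) (X : topologicalType).
Hypothesis hX : paracompact X.

Lemma nbhs_CU (x : X) : nbhs (x : CU R X) = nbhs x.
Proof.
suff nbhsX (U : set X) : nbhs x U -> nbhs (x : CU R X) U.
  apply/seteqP; split=> U; last exact: nbhsX.
  move=> /nbhsP[E [S [f [pf fE]]] EU].
  have [s /= fs] := pou_ent_refl pf x; have [fc f01 _] := pf.
  have fx : 0 < f s x.
    rewrite lt_neqAle; case/andP: (f01 s x) => -> _; rewrite andbT.
    by apply: contraTneq fs => <-; rewrite mul0r ltxx.
  have : \forall y \near x, 0 < f s y by apply: (cvgr_gt _ (fc s x)).
  apply: filterS => y fy; apply: EU; apply/mem_set; apply: fE.
  by exists s => /=; exact: mulr_gt0.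
move=> Ux; pose C := [set W : set X | open W /\ (W `<=` U \/ ~ W x)].
have cX : closed [set x].
  by apply: accessible_closed_set1; apply: hausdorff_accessible; case: hX.
have [|y|F [entF _] FC] := @subordinate_entourage R X hX C;
    first by move=> W [].
  have [->|/eqP yx] := eqVneq y x.
    exists U°; last exact: Ux.
    by split; [exact: open_interior|left; exact: interior_subset].
  exists (~` [set x]) => //; split; first by rewrite openC.
  by right; apply.
apply/nbhsP; exists F => // y /set_mem /FC[W [_ WUx] [Wx Wy]].
by case: WUx => [|/(_ Wx)//]; apply.
Qed.

Lemma continuous_to_CU : continuous (id : X -> CU R X).
Proof. by move=> x U; rewrite /= nbhs_CU. Qed.

Lemma continuous_from_CU : continuous (id : CU R X -> X).
Proof. by move=> x U; rewrite /= nbhs_CU. Qed.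

End Topology.

(** * Local connectedness *)

Section UniformBalls.
Context (T : uniformType).
Implicit Types (x y : T) (E : set (T * T)) (U : set T).

Lemma nbhs_ball_entourage E y : sym_entourage E -> nbhs y [set z | E (y, z)].
Proof.
by move=> [entE _]; apply: filterS (nbhs_entourage y entE) => z /set_mem.
Qed.

(** Bounded sets are contained in balls about an arbitrary centre, so a
splitting is needed to control those passing through a given point y. *)
Lemma small_entourage y U : nbhs y U ->
  exists2 E, sym_entourage E & forall A, ent_bounded E A -> A y -> A `<=` U.
Proof.
move=> /nbhsP[E entE EU]; have entS := entourage_split_ent entE.
exists (split_ent E `&` (split_ent E)^-1)%relation.
  split; first by apply: filterI => //; exact: entourage_inv.
  by apply/seteqP; split=> -[a b] [? ?]; split.
move=> A [w Aw] Ay z Az; apply: EU; apply/mem_set.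
apply: (@entourage_split _ w) => //; first by have [] := Aw y Ay.
by have [] := Aw z Az.
Qed.

End UniformBalls.

Section Connected.
Context (R : realType) (X : topologicalType).
Hypothesis hX : paracompact X.

Lemma connected_image (T T' : topologicalType) (f : T -> T') (A : set T) :
  continuous f -> connected A -> connected (f @` A).
Proof.
move=> cf cA; apply: connected_continuous_connected => //.
exact: continuous_subspaceT.
Qed.

Lemma locally_connected_CU :
  locally_connected X <-> uniformly_locally_connected (CU R X).
Proof.
split=> [lcX E symE|ulcX x U Ux].
  pose C := [set V : set X |
    [/\ open V, connected V & @ent_bounded (CU R X) E V]].
  have [|x|F symF FC] := @subordinate_entourage R X hX C; first by move=> V [].
    have := nbhs_ball_entourage (x : CU R X) symE; rewrite nbhs_CU// => /lcX.
    by move=> [V [oV Vx cV VE]]; exists V => //; split=> //; exists x.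
  exists F => // x y /FC[V [oV cV bV] [Vx Vy]]; exists V; split=> //.
  by have := connected_image (@continuous_to_CU R X hX) cV; rewrite image_id.
(* V is the connected component of x in the interior of U. *)
pose V := \bigcup_(A in [set A | [/\ A x, connected A & A `<=` U°]]) A.
have VU : V `<=` U° by move=> y [A [_ _ AU] /AU].
have Vx : V x.
  by exists [set x] => //; split=> // [|_ ->]; [exact: connected1|exact: Ux].
have cV : connected V.
  by apply: bigcup_connected; [exists x => A []|move=> A []].
exists V; split=> //; last exact: subset_trans VU (@interior_subset _ _).
rewrite openE => y Vy.
have : nbhs (y : CU R X) U°.
  rewrite nbhs_CU//; apply: open_nbhs_nbhs.
  by split; [exact: open_interior|exact: VU].
move=> /small_entourage[E symE EU]; have [F symF FE] := ulcX E symE.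
have := nbhs_ball_entourage (y : CU R X) symF; rewrite nbhs_CU//.
apply: filterS => z /= /FE[A [cA bA Ay Az]]; exists (V `|` A); last by right.
split; first by left.
  apply: connectedU => //; first by exists y.
  by have := connected_image (@continuous_from_CU R X hX) cA; rewrite image_id.
by move=> w [/VU//|]; exact: EU.
Qed.

End Connected.

(** * The unit interval as a retract of the line *)

Section UnitInterval.
Context (R : realType).
Local Notation I := (unit_interval R).

Definition clamp (t : R) : R := Num.max 0 (Num.min t 1).

Lemma clamp_cont : continuous clamp.
Proof.
move=> t; apply: (@continuous_max R R^o (fun=> 0) (fun t => Num.min t 1)).
  exact: cvg_cst.
by apply: (@continuous_min _ _ id (fun=> 1)); [exact: cvg_id|exact: cvg_cst].
Qed.

Lemma clamp_itv t : 0 <= clamp t <= 1.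
Proof. by rewrite /clamp le_max lexx/= ge_max ler01 ge_min lexx orbT. Qed.

Lemma clamp_id t : 0 <= t <= 1 -> clamp t = t.
Proof. by move=> /andP[t0 t1]; rewrite /clamp min_l// max_r. Qed.

Lemma clamp_le0 t : t <= 0 -> clamp t = 0.
Proof. by move=> t0; rewrite /clamp min_l ?max_l//; lra. Qed.

Lemma clamp_ge1 t : 1 <= t -> clamp t = 1.
Proof. by move=> t1; rewrite /clamp min_r ?max_r. Qed.

Let clamp_mem t : clamp t \in (`[0, 1]%classic : set R).
Proof. by rewrite inE/= in_itv/= clamp_itv. Qed.

Definition to_I (t : R) : I := exist _ (clamp t) (clamp_mem t).

Definition of_I (s : I) : R := \val s.

Lemma of_I_itv s : 0 <= of_I s <= 1.
Proof. by have := valP s; rewrite inE/= in_itv. Qed.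

Lemma of_IK : cancel of_I to_I.
Proof. by move=> s; apply: val_inj => /=; rewrite clamp_id// of_I_itv. Qed.

Lemma to_IK t : 0 <= t <= 1 -> of_I (to_I t) = t.
Proof. exact: clamp_id. Qed.

Lemma of_I0 : of_I zero = 0. Proof. by []. Qed.
Lemma of_I1 : of_I one = 1. Proof. by []. Qed.

Lemma to_I0 : to_I 0 = zero. Proof. by rewrite -(of_IK zero). Qed.
Lemma to_I1 : to_I 1 = one. Proof. by rewrite -(of_IK one). Qed.

Lemma of_I_cont : continuous of_I.
Proof. exact: initial_continuous. Qed.

Lemma to_I_cont : continuous to_I.
Proof.
apply: (@continuous_comp_initial _ R R (\val : I -> R) to_I).
exact: clamp_cont.
Qed.

End UnitInterval.

Section Paste.
Context (R : realType) (Y T : topologicalType).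

Lemma paste_continuous (phi : Y -> R) (c : R) (f g : Y -> T) :
  continuous phi -> continuous f -> continuous g ->
  (forall y, phi y = c -> f y = g y) ->
  continuous (fun y => if phi y <= c then f y else g y).
Proof.
move=> cphi cf cg fg y U /=; have [yc|yc|yc] := ltgtP (phi y) c => Uy.
- have Uf : \forall z \near y, U (f z) := cf y U Uy.
  have near_c : \forall z \near y, phi z < c by exact: (cvgr_lt _ (cphi y)).
  by apply: filterS2 Uf near_c => z /= Uz /ltW ->.
- have Ug : \forall z \near y, U (g z) := cg y U Uy.
  have near_c : \forall z \near y, c < phi z by exact: (cvgr_gt _ (cphi y)).
  by apply: filterS2 Ug near_c => z /= Uz; rewrite ltNge => /negbTE ->.
- have Uf : \forall z \near y, U (f z) := cf y U Uy.
  have Ug : \forall z \near y, U (g z) by apply: (cg y U); rewrite -fg.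
  by apply: filterS2 Uf Ug => z /=; case: ifP.
Qed.

End Paste.

(** * Joining points by paths inside a set *)

Section Joined.
Context (R : realType).
Local Notation I := (unit_interval R).

(** Paths in A, as curves on the whole line: any path extends to a curve with
the same image, and pieces of curves can be reparametrized without keeping
track of the bounds of the parameter. *)
Definition joined (T : topologicalType) (A : set T) (x y : T) :=
  exists c : R -> T, [/\ continuous c, c 0 = x, c 1 = y & forall t, A (c t)].

Lemma path_curve (T : topologicalType) (x y : T)
    (p : {path I from x to y in T}) :
  [/\ continuous (p \o @to_I R), (p \o @to_I R) 0 = x & (p \o @to_I R) 1 = y].
Proof.
split=> [t| |] /=; [|by rewrite to_I0 path_zero|by rewrite to_I1 path_one].
by apply: continuous_comp; [exact: to_I_cont|exact: cts_fun].
Qed.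

Lemma curve_path (T : topologicalType) (x y : T) (c : R -> T) :
  continuous c -> c 0 = x -> c 1 = y ->
  exists p : {path I from x to y in T}, forall s, p s = c (of_I s).
Proof.
move=> cc c0 c1; have cp : continuous (c \o @of_I R).
  by move=> s; apply: continuous_comp; [exact: of_I_cont|exact: cc].
have p0 : (c \o @of_I R) zero = x by rewrite /= of_I0.
have p1 : (c \o @of_I R) one = y by rewrite /= of_I1.
by exists (mk_path cp p0 p1).
Qed.

Lemma path_joined (T : topologicalType) (A : set T) x y :
  (exists p : {path I from x to y in T}, range p `<=` A) <-> joined A x y.
Proof.
split=> [[p pA]|[c [cc c0 c1 cA]]].
  have [cp p0 p1] := path_curve p; exists (p \o @to_I R); split=> // t.
  by apply: pA; exists (to_I t).
have [p pE] := curve_path cc c0 c1.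
by exists p => _ [s _ <-]; rewrite pE.
Qed.

Lemma joined_map (T T' : topologicalType) (f : T -> T')
    (A : set T) (B : set T') x y :
  continuous f -> (forall z, A z -> B (f z)) -> joined A x y ->
  joined B (f x) (f y).
Proof.
move=> cf AB [c [cc <- <- cA]]; exists (f \o c); split=> // t; last exact: AB.
by apply: continuous_comp; [exact: cc|exact: cf].
Qed.

Section Equivalence.
Context (T : topologicalType) (A : set T).

Lemma joined_refl x : A x -> joined A x x.
Proof. by move=> Ax; exists (fun=> x); split=> // t; exact: cvg_cst. Qed.

Lemma joined_sym x y : joined A x y -> joined A y x.
Proof.
move=> [c [cc c0 c1 cA]]; exists (fun t => c (1 - t)); split=> //.
- move=> t; apply: continuous_comp; last exact: cc.
  by apply: cvgB; [exact: cvg_cst|exact: cvg_id].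
- by rewrite subr0.
- by rewrite subrr.
Qed.

Lemma joined_trans y x z : joined A x y -> joined A y z -> joined A x z.
Proof.
move=> [c [cc c0 c1 cA]] [d [cd d0 d1 dA]].
exists (fun t => if t <= 1 / 2 then c (2 * t) else d (2 * t - 1)); split.
- apply: (@paste_continuous R R T id) => [t|t|t|t ->].
  + exact: cvg_id.
  + apply: (@continuous_comp _ _ _ (fun t : R => 2 * t) c); last exact: cc.
    by apply: cvgM; [exact: cvg_cst|exact: cvg_id].
  + apply: (@continuous_comp _ _ _ (fun t : R => 2 * t - 1) d); last exact: cd.
    apply: cvgB; last exact: cvg_cst.
    by apply: cvgM; [exact: cvg_cst|exact: cvg_id].
  + have -> : 2 * (1 / 2) = 1 :> R by lra.
    by rewrite subrr c1.
- by rewrite ifT ?mulr0//; lra.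
- by rewrite ifF; [rewrite -d1; congr d; lra|apply/negbTE; rewrite -ltNge; lra].
- by move=> t; case: ifP.
Qed.

(** Every point of a path in A starting at x is itself joined to x in A, so
path components are path-connected. *)
Lemma joined_component x y : joined A x y -> joined [set z | joined A x z] x y.
Proof.
move=> [c [cc c0 c1 cA]]; exists c; split=> // t.
exists (fun s => c (t * s)); split=> //; last 2 first.
- by rewrite mulr0.
- by rewrite mulr1.
move=> s; apply: continuous_comp; last exact: cc.
by apply: cvgM; [exact: cvg_cst|exact: cvg_id].
Qed.

Lemma joined_mem x y : joined A x y -> A x /\ A y.
Proof. by move=> [c [_ <- <- cA]]. Qed.

End Equivalence.
End Joined.

(** * Local path-connectedness *)

Section PathConnected.
Context (R : realType) (X : topologicalType).
Hypothesis hX : paracompact X.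

Lemma locally_path_connected_CU :
  locally_path_connected R X <-> uniformly_locally_path_connected R (CU R X).
Proof.
split=> [lcX E symE|ulcX x U Ux].
  pose C := [set V : set X |
    [/\ open V, path_connected R V & @ent_bounded (CU R X) E V]].
  have [|x|F symF FC] := @subordinate_entourage R X hX C; first by move=> V [].
    have := nbhs_ball_entourage (x : CU R X) symE; rewrite nbhs_CU// => /lcX.
    by move=> [V [oV Vx cV VE]]; exists V => //; split=> //; exists x.
  exists F => // x y /FC[V [oV cV [w Vw]] [Vx Vy]].
  have /path_joined/(joined_map (@continuous_to_CU R X hX) Vw) := cV x y Vx Vy.
  by move=> /path_joined[p pE]; exists p; exists w.
(* V is the path component of x in the interior of U. *)
pose V := [set y | @joined R X U° x y].
have VU : V `<=` U° by move=> y Vy; have [] := joined_mem Vy.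
have Vx : V x by apply: joined_refl; exact: Ux.
exists V; split=> //; last 2 first.
- move=> a b Va Vb; apply/path_joined; apply: (@joined_trans _ _ _ x).
    by apply: joined_sym; exact: joined_component.
  exact: joined_component.
- exact: subset_trans VU (@interior_subset _ _).
rewrite openE => y Vy.
have : nbhs (y : CU R X) U°.
  rewrite nbhs_CU//; apply: open_nbhs_nbhs.
  by split; [exact: open_interior|exact: VU].
move=> /small_entourage[E symE EU]; have [F symF FE] := ulcX E symE.
have := nbhs_ball_entourage (y : CU R X) symF; rewrite nbhs_CU//.
apply: filterS => z /= /FE[p pE]; apply: joined_trans Vy _.
apply: (joined_map (@continuous_from_CU R X hX) (A := range p)) => [w|].
  by apply: EU => //; exists zero => //; exact: path_zero.
by apply/path_joined; exists p.
Qed.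

End PathConnected.

(** * Continuity of real expressions *)

Section RealContinuity.
Context (R : realType) (Y : topologicalType).
Implicit Types f g : Y -> R.

Lemma cont_cst (k : R) : continuous (fun _ : Y => k).
Proof. by move=> y; exact: cvg_cst. Qed.

Lemma cont_add f g : continuous f -> continuous g ->
  continuous (fun y => f y + g y).
Proof. by move=> cf cg y; apply: cvgD; [exact: cf|exact: cg]. Qed.

Lemma cont_sub f g : continuous f -> continuous g ->
  continuous (fun y => f y - g y).
Proof. by move=> cf cg y; apply: cvgB; [exact: cf|exact: cg]. Qed.

Lemma cont_mul f g : continuous f -> continuous g ->
  continuous (fun y => f y * g y).
Proof. by move=> cf cg y; apply: cvgM; [exact: cf|exact: cg]. Qed.

Lemma cont_norm f : continuous f -> continuous (fun y => `|f y|).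
Proof. by move=> cf y; apply: cvg_norm; exact: cf. Qed.

Lemma cont_clamp f : continuous f -> continuous (fun y => clamp (f y)).
Proof.
by move=> cf y; apply: continuous_comp; [exact: cf|exact: clamp_cont].
Qed.

Lemma cont_pair (A B T : topologicalType) (h : A * B -> T)
    (f : Y -> A) (g : Y -> B) :
  continuous h -> continuous f -> continuous g ->
  continuous (fun y => h (f y, g y)).
Proof.
move=> ch cf cg y.
apply: (@continuous_comp _ _ _ (fun y => (f y, g y)) h); last exact: ch.
exact: cvg_pair (cf y) (cg y).
Qed.

End RealContinuity.

Lemma cont_id (R : realType) : continuous (fun t : R => t).
Proof. by move=> t; exact: cvg_id. Qed.

Lemma cont_fst (R : realType) : continuous (fun st : R * R => st.1).
Proof. by move=> st; exact: cvg_fst. Qed.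

Lemma cont_snd (R : realType) : continuous (fun st : R * R => st.2).
Proof. by move=> st; exact: cvg_snd. Qed.

Ltac continuity := try assumption; try by [];
  lazymatch goal with
  | |- forall _, continuous_at _ (fun y => clamp (@?f y)) =>
      apply: (cont_clamp (f := f)); continuity
  | |- forall _, continuous_at _ (fun y => `|@?f y|) =>
      apply: (cont_norm (f := f)); continuity
  | |- forall _, continuous_at _ (fun y => @?f y - @?g y) =>
      apply: (cont_sub (f := f) (g := g)); continuity
  | |- forall _, continuous_at _ (fun y => @?f y + @?g y) =>
      apply: (cont_add (f := f) (g := g)); continuity
  | |- forall _, continuous_at _ (fun y => @?f y * @?g y) =>
      apply: (cont_mul (f := f) (g := g)); continuity
  | |- forall _, continuous_at _ (fun y => fst y) => exact: cont_fst
  | |- forall _, continuous_at _ (fun y => snd y) => exact: cont_snd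
  | |- forall _, continuous_at _ (fun y => y) => exact: cont_id
  | |- forall _, continuous_at _ (fun y => ?k) => exact: cont_cst
  end.

(** * Null-homotopic loops and change of base point *)

Section NullLoops.
Context (R : realType).
Local Notation I := (unit_interval R).

Definition null_loop (T : topologicalType) (x : T) (c : R -> T) :=
  exists h : R * R -> T,
    [/\ continuous h,
        forall s, 0 <= s <= 1 -> h (s, 0) = c s,
        forall s, 0 <= s <= 1 -> h (s, 1) = x &
        forall t, 0 <= t <= 1 -> h (0, t) = x /\ h (1, t) = x].

Lemma null_homotopicP (T : topologicalType) (x : T)
    (p : {path I from x to x in T}) :
  null_homotopic p <-> null_loop x (p \o @to_I R).
Proof.
split=> [[H [cH H0 H1 Hx]]|[h [ch h0 h1 hx]]].
  exists (fun st => H (to_I st.1, to_I st.2)); split=> [st|s _|s _|t _] /=.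
  - move: st; apply: cont_pair cH _ _ => st.
      by apply: continuous_comp; [exact: cvg_fst|exact: to_I_cont].
    by apply: continuous_comp; [exact: cvg_snd|exact: to_I_cont].
  - by rewrite to_I0 H0.
  - by rewrite to_I1 H1.
  - by rewrite to_I0 to_I1; exact: Hx.
exists (fun st => h (of_I st.1, of_I st.2)); split=> [|s|s|t] /=.
- apply: cont_pair ch _ _ => st.
    by apply: continuous_comp; [exact: cvg_fst|exact: of_I_cont].
  by apply: continuous_comp; [exact: cvg_snd|exact: of_I_cont].
- by rewrite of_I0 h0 ?of_I_itv//= of_IK.
- by rewrite of_I1 h1 ?of_I_itv.
- by rewrite of_I0 of_I1; apply: hx; exact: of_I_itv.
Qed.

Lemma null_loop_map (T T' : topologicalType) (f : T -> T') x c :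
  continuous f -> null_loop x c -> null_loop (f x) (f \o c).
Proof.
move=> cf [h [ch h0 h1 hx]]; exists (f \o h).
split=> /= [st|s /h0->|s /h1->|t /hx[-> ->]] //.
by apply: continuous_comp; [exact: ch|exact: cf].
Qed.

Lemma loops_null_homotopic (T : topologicalType) (x : T) (U : set T) :
  (forall p : {path I from x to x in T}, range p `<=` U -> null_homotopic p) <->
  (forall c : R -> T, continuous c -> c 0 = x -> c 1 = x ->
    (forall t, U (c t)) -> null_loop x c).
Proof.
split=> [pU c cc c0 c1 cU|cU p pU]; last first.
  have [cp p0 p1] := path_curve p.
  by apply/null_homotopicP; apply: cU => // t; apply: pU; exists (to_I t).
have [p pE] := curve_path cc c0 c1.
have /null_homotopicP[h [ch h0 h1 hx]] : null_homotopic p.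
  by apply: pU => _ [s _ <-]; rewrite pE.
by exists h; split=> // s s01; rewrite h0//= pE to_IK.
Qed.

Section ChangeBase.
Context (T : topologicalType).
Implicit Types (x y : T) (a c : R -> T).

(** G is a free homotopy from c to a constant loop, along which the base point
runs through the curve d t = G (0, t) = G (1, t). Surround the square by a
collar: at distance e to the left or right of the point of height t on a
lateral side, take the value d (t - e), frozen at y = d 0 once e exceeds t;
above the top side, run d backwards to y. At height t <= 1, the curve that
travels from e = t on the left to e = t on the right starts and ends at y; it
is c for t = 0. At height t = 1 it is d, then a constant, then the reverse of
d, and running d backwards above the top side contracts it to y. *)
Lemma freely_null_loop x y c (G : R * R -> T) : continuous G ->
  (forall s, 0 <= s <= 1 -> G (s, 0) = c s) ->
  (forall s, 0 <= s <= 1 -> G (s, 1) = x) ->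
  (forall t, 0 <= t <= 1 -> G (0, t) = G (1, t)) ->
  c 0 = y -> null_loop y c.
Proof.
move=> cG G0 G1 Gside c0.
have G00 : G (0, 0) = y by rewrite G0 ?c0// lexx ler01.
have G10 : G (1, 0) = y by rewrite -Gside// lexx ler01.
(* At height t of the homotopy, s runs over [- m, 1 + m] through u; the distance
   from u to the original square is e. *)
pose m (st : R * R) : R := clamp (2 * st.2).
pose u st : R := (1 + 2 * m st) * st.1 - m st.
pose e st := `|u st - clamp (u st)|.
have cm : continuous m by rewrite /m; continuity.
have cu : continuous u by rewrite /u; continuity.
have ce : continuous e by rewrite /e; continuity.
exists (fun st =>
  if st.2 <= 1 / 2 then G (clamp (u st), clamp (2 * st.2 - e st))
  else G (0, clamp (2 - 2 * st.2 - e st))); split.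
- apply: paste_continuous; first exact: cont_snd.
  + apply: cont_pair => //; first exact: cont_clamp.
    by continuity.
  + apply: cont_pair => //; first by continuity.
    by continuity.
  + move=> [s t] /= ->; have -> : 2 - 2 * (1 / 2) = 1 :> R by lra.
    have -> : 2 * (1 / 2) = 1 :> R by lra.
    have [u0|u0] := leP (u (s, 1 / 2)) 0; first by rewrite (clamp_le0 u0).
    have [u1|u1] := leP 1 (u (s, 1 / 2)).
      by rewrite (clamp_ge1 u1) -Gside// clamp_itv.
    have cuE : clamp (u (s, 1/2)) = u (s, 1/2) by rewrite clamp_id// !ltW.
    rewrite /e cuE subrr normr0 subr0 clamp_ge1//.
    by rewrite !G1// ?lexx ?ler01// !ltW.
- move=> s s01 /=; rewrite ifT; last by lra.
  have m0 : m (s, 0) = 0 by rewrite /m /= mulr0 clamp_le0.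
  have us : u (s, 0) = s by rewrite /u m0/=; lra.
  by rewrite /e us clamp_id// subrr normr0 mulr0 subr0 clamp_le0// G0.
- move=> s s01 /=; rewrite ifF; last by apply/negbTE; rewrite -ltNge; lra.
  rewrite clamp_le0//.
  have : 0 <= e (s, 1) by exact: normr_ge0.
  lra.
- move=> t t01 /=; have [t2|t2] := leP t (1 / 2).
    have mt : m (0, t) = 2 * t by rewrite /m /= clamp_id//; lra.
    have mt' : m (1, t) = 2 * t by rewrite /m /= clamp_id//; lra.
    have u0 : u (0, t) = - (2 * t) by rewrite /u mt /=; lra.
    have u1 : u (1, t) = 1 + 2 * t by rewrite /u mt' /=; lra.
    have cu0 : clamp (u (0, t)) = 0 by rewrite clamp_le0// u0; lra.
    have cu1 : clamp (u (1, t)) = 1 by rewrite clamp_ge1// u1; lra.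
    have e0 : e (0, t) = 2 * t by rewrite /e cu0 u0 ler0_norm; lra.
    have e1 : e (1, t) = 2 * t by rewrite /e cu1 u1 ger0_norm; lra.
    by rewrite cu0 cu1 e0 e1 subrr clamp_le0.
  have mt : m (0, t) = 1 by rewrite /m /= clamp_ge1//; lra.
  have mt' : m (1, t) = 1 by rewrite /m /= clamp_ge1//; lra.
  have u0 : u (0, t) = - 1 by rewrite /u mt /=; lra.
  have u1 : u (1, t) = 2 by rewrite /u mt' /=; lra.
  have e0 : e (0, t) = 1.
    by rewrite /e u0 clamp_le0 ?ler0_norm; lra.
  have e1 : e (1, t) = 1.
    by rewrite /e u1 clamp_ge1 ?ger0_norm; lra.
  by rewrite e0 e1 clamp_le0//; lra.
Qed.

(** Let b = a c a^-1, the three pieces having equal length. A null-homotopy h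
of b is a square whose bottom side is b and whose other sides are constant.
Sweeping a segment of this square, which starts as the middle third of the
bottom side, first widens to the whole bottom side and then rises to the top,
yields a free homotopy from c to a constant: both ends of the segment see the
reverse of a, and then x. *)
Lemma conjugate_loop (U : set T) x y a c : continuous a -> a 0 = x -> a 1 = y ->
  (forall t, U (a t)) -> continuous c -> c 0 = y -> c 1 = y ->
  (forall t, U (c t)) ->
  (forall b : R -> T, continuous b -> b 0 = x -> b 1 = x ->
    (forall t, U (b t)) -> null_loop x b) ->
  null_loop y c.
Proof.
move=> ca a0 a1 aU cc c0 c1 cU nullU.
pose b (t : R) := if t <= 1 / 3 then a (3 * t)
  else if t <= 2 / 3 then c (3 * t - 1) else a (3 - 3 * t).
have b_left t : t <= 1 / 3 -> b t = a (3 * t) by move=> t3; rewrite /b t3.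
have b_mid t : 1 / 3 <= t <= 2 / 3 -> b t = c (3 * t - 1).
  move=> /andP[t1 t2]; rewrite /b t2; case: ifP => // t3.
  have -> : t = 1 / 3 by lra.
  have -> : 3 * (1 / 3) = 1 :> R by lra.
  by rewrite subrr a1 c0.
have b_right t : 2 / 3 <= t -> b t = a (3 - 3 * t).
  move=> t2; rewrite /b ifF; last by apply/negbTE; rewrite -ltNge; lra.
  case: ifP => // t3; have -> : t = 2 / 3 by lra.
  have -> : 3 * (2 / 3) - 1 = 1 :> R by lra.
  have -> : 3 - 3 * (2 / 3) = 1 :> R by lra.
  by rewrite c1 a1.
have cont_comp f (d : R -> T) : continuous f -> continuous d ->
    continuous (fun t : R => d (f t)).
  by move=> cf cd t; apply: continuous_comp; [exact: cf|exact: cd].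
have [|||t|h [ch h0 h1 hx]] := nullU b.
- apply: (@paste_continuous R R T id); first exact: cont_id.
  + apply: cont_comp => // t.
    by apply: cvgM; [exact: cvg_cst|exact: cvg_id].
  + apply: (@paste_continuous R R T id); first exact: cont_id.
    * by apply: (cont_comp (fun t => 3 * t - 1)) => //; continuity.
    * by apply: cont_comp => //; continuity.
    * move=> t ->; have -> : 3 * (2 / 3) - 1 = 1 :> R by lra.
      have -> : 3 - 3 * (2 / 3) = 1 :> R by lra.
      by rewrite c1 a1.
  + move=> t ->; rewrite ifT; last by lra.
    have -> : 3 * (1 / 3) = 1 :> R by lra.
    by rewrite subrr a1 c0.
- by rewrite b_left ?mulr0//; lra.
- by rewrite b_right ?mulr1 ?subrr//; lra.
- by rewrite /b; case: ifP => // _; case: ifP.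
(* The segment [(1 - m) / 3, (2 + m) / 3] widens while t <= 1 / 2; it rises
   afterwards. *)
pose m (st : R * R) : R := clamp (2 * st.2).
have cm : continuous m by rewrite /m; continuity.
apply: (@freely_null_loop x y c (fun st =>
  h ((1 - m st + st.1 * (1 + 2 * m st)) / 3, clamp (2 * st.2 - 1)))) => //.
- by apply: cont_pair => //; continuity.
- move=> s s01 /=; have -> : m (s, 0) = 0 by rewrite /m /= mulr0 clamp_le0.
  rewrite clamp_le0; last by lra.
  rewrite h0; last by lra.
  by rewrite b_mid; [congr c; lra|lra].
- move=> s s01 /=; have -> : m (s, 1) = 1 by rewrite /m /= clamp_ge1//; lra.
  rewrite clamp_ge1; last by lra.
  by rewrite h1//; lra.
- move=> t t01 /=; have [t2|t2] := leP t (1 / 2).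
    have mt s : m (s, t) = 2 * t by rewrite /m /= clamp_id//; lra.
    rewrite !mt clamp_le0; last by lra.
    rewrite !h0; [|lra|lra].
    rewrite b_left; last by lra.
    rewrite b_right; last by lra.
    by congr a; lra.
  have mt s : m (s, t) = 1 by rewrite /m /= clamp_ge1//; lra.
  have cl := clamp_itv (2 * t - 1); have [hx0 hx1] := hx _ cl.
  rewrite !mt; have -> : (1 - 1 + 0 * (1 + 2 * 1)) / 3 = 0 :> R by lra.
  by have -> : (1 - 1 + 1 * (1 + 2 * 1)) / 3 = 1 :> R; [lra|rewrite hx0 hx1].
Qed.

End ChangeBase.
End NullLoops.

(** * Semi-local simple connectedness *)

Section SemiLocally.
Context (R : realType) (X : topologicalType).
Hypothesis hX : paracompact X.

Lemma semi_locally_simply_connected_CU : locally_path_connected R X ->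
  semi_locally_simply_connected R X <->
  uniformly_semi_locally_simply_connected R (CU R X).
Proof.
move=> lpcX; split=> [slX|[F symF FX] x].
  pose C := [set V : set X | open V /\ exists x, [/\ V x, path_connected R V &
    forall p : {path (unit_interval R) from x to x in X},
      range p `<=` V -> null_homotopic p]].
  have [|x|F symF FC] := @star_subordinate_entourage R X hX C;
      first by move=> V [].
    have [U Ux UX] := slX x; have [V [oV Vx cV VU]] := lpcX x U Ux.
    exists V => //; split=> //; exists x; split=> // p pV.
    by apply: UX; exact: subset_trans VU.
  exists F => // y p [z pz]; have [V [oV [x [Vx cV VX]]] FV] := FC z.
  have pV t : V (p t) by apply: FV; apply: pz; exists t.
  have Vy : V y by rewrite -(@path_zero _ _ _ _ p).
  have /path_joined[a [ca a0 a1 aV]] := cV x y Vx Vy.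
  apply/null_homotopicP.
  suff /(null_loop_map (@continuous_to_CU R X hX)) :
    @null_loop R X y (fun t => p (to_I t)) by [].
  have [cp p0 p1] := path_curve p.
  apply: (conjugate_loop ca a0 a1 aV) => // [t|].
    exact: (continuous_comp (cp t) (@continuous_from_CU R X hX _)).
  by apply/loops_null_homotopic.
exists [set y | F (x, y)].
  by have := nbhs_ball_entourage (x : CU R X) symF; rewrite nbhs_CU.
apply/loops_null_homotopic => c cc c0 c1 cF.
suff /(null_loop_map (@continuous_from_CU R X hX)) :
  @null_loop R (CU R X) x c by [].
have [nullF _] := @loops_null_homotopic R (CU R X) x [set y | F (x, y)].
apply: nullF => // [p pF|t]; first by apply: FX; exists x.
by exact: (continuous_comp (cc t) (@continuous_to_CU R X hX _)).
Qed.

End SemiLocally.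

Theorem proposition2p7 (R : realType) (X : topologicalType)
    (hX : paracompact X) :
  [/\ locally_connected X <-> uniformly_locally_connected (CU R X),
      locally_path_connected R X <->
        uniformly_locally_path_connected R (CU R X) &
      locally_path_connected R X ->
        (semi_locally_simply_connected R X <->
         uniformly_semi_locally_simply_connected R (CU R X))].
Proof.
split.
- exact: locally_connected_CU.
- exact: locally_path_connected_CU.
- exact: semi_locally_simply_connected_CU.
Qed.
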